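(* Let $\ell \geq 4$ be an even integer and $t \geq 1$ an integer. Let $\gamma$ be the unique integer such that \[ 2\ell + 2 \;\geq\; \ell + 3 - 4(t+2) + \gamma(2\ell+2) \;\geq\; 1, \] let $j = 2\gamma + 1$, and let $r = \ell + 3 - 4(t+2) + \gamma(2\ell+2)$. If $k$ is any integer with $k \geq 4t + 2\ell + 2|\gamma| + 2$, then there is a symmetric complete $(\ell,1)$-sum-free set $S \subseteq \mathbb{Z}_{(2\ell+2)k + r}$.
   Context: For a subset $S$ of an abelian group $\Gamma$ (written additively) and a positive integer $\ell$, the $\ell$-fold sumset is $\ell S = \{ s_1 + s_2 + \dots + s_\ell : s_i \in S\}$. The set $S$ is $(\ell,1)$-sum-free if $(\ell S) \cap S = \emptyset$; such a set is complete if moreover $\ell S \cup S = \Gamma$ (so $\ell S$ and $S$ partition $\Gamma$). $S$ is symmetric if $s \in S$ implies $-s \in S$. $\mathbb{Z}_n$ denotes the cyclic group of integers modulo $n$. *)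

(* Defs.v *)
From HB Require Import structures.
From mathcomp Require Import all_boot all_order all_algebra.
From mathcomp Require Import zify.

Set Implicit Arguments.
Unset Strict Implicit.
Unset Printing Implicit Defensive.

Import Order.TTheory GRing.Theory Num.Theory.
Local Open Scope ring_scope.

Definition sumset (G : finZmodType) (l : nat) (S : {set G}) : {set G} :=
  [set \sum_(i < l) s i | s : {ffun 'I_l -> G} & [forall i, s i \in S]].

(* (l, 1)-sum-free *)
Definition sum_free (G : finZmodType) (l : nat) (S : {set G}) : Prop :=
  sumset l S :&: S = set0.

Definition complete_sum_free (G : finZmodType) (l : nat) (S : {set G}) : Prop :=
  sum_free l S /\ sumset l S :|: S = [set: G].

Definition symmetric_set (G : finZmodType) (S : {set G}) : Prop :=
  forall s, s \in S -> - s \in S.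

(* The theorem quantifies over every gamma satisfying the inequality below;
   this shows that it is exactly one integer. *)
Lemma gamma_exists_unique (l t : nat) :
  exists! gamma : int,
    1 <= l%:Z + 3 - 4 * (t%:Z + 2) + gamma * (2 * l%:Z + 2) <= 2 * l%:Z + 2.
Proof.
pose a : int := l%:Z + 3 - 4 * (t%:Z + 2) - 1.
pose m : int := 2 * l%:Z + 2.
have m0 : m != 0 by rewrite /m; lia.
have ha := divz_eq a m.
have r0 := modz_ge0 a m0.
have rm : (a %% m)%Z < m by apply: ltz_pmod; rewrite /m; lia.
exists (- (a %/ m)%Z); split.
  by rewrite /a /m in ha r0 rm *; nia.
move=> g hg.
by rewrite /a /m in ha r0 rm *; nia.
Qed.

(* Main.v *)
(** Let [B] be a symmetric numerical semigroup with Frobenius number [N], that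
    is, exactly one of [z] and [N - z] lies in [B] for every integer [z]. Since
    [l] is even, [n = (l + 1) M - 2 N] can be written [n = 2 w + M] with
    [w = (l / 2) M - N]. Take [S = w + C_1] modulo [n], where [C_m] is the set of
    [z] such that both [z] and [m M - z] lie in [B]. If [M > 3 N + 1] then
    [l C_1 = C_l], so [l S = l w + C_l = C_l - w - N]; by the symmetry of [B] at
    either end of the interval, this is exactly the complement of [S]. The
    theorem follows with [M = 2 (k + gamma) + 1], [N = 2 t + 3] and [B]
    consisting of the even naturals and all integers above [N]. *)
Require Import Defs.
From HB Require Import structures.
From mathcomp Require Import all_boot all_order all_algebra.
From mathcomp Require Import zify ring.

Set Implicit Arguments.
Unset Strict Implicit.
Unset Printing Implicit Defensive.

Import Order.TTheory GRing.Theory Num.Theory.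
Local Open Scope ring_scope.

Lemma intr_Zp_eq0 (n : nat) (m : int) : (1 < n)%N ->
  (m%:~R == 0 :> 'Z_n) = (n%:Z %| m)%Z.
Proof.
move=> n1; have nat0 (a : nat) : (a%:R == 0 :> 'Z_n) = (n %| a)%N.
  by rewrite -val_eqE /= Zp_nat /= Zp_cast.
case: m => a; first by rewrite -pmulrn nat0.
by rewrite NegzE mulrNz oppr_eq0 -pmulrn nat0 dvdzE abszN.
Qed.

Lemma intr_Zp_eqP (n : nat) (x y : int) : (1 < n)%N ->
  reflect (exists q : int, x = y + q * n%:Z) (x%:~R == y%:~R :> 'Z_n).
Proof.
move=> n1; rewrite -subr_eq0 -mulrzBr intr_Zp_eq0 //.
apply: (iffP dvdzP) => -[q hq]; exists q; first by rewrite -hq addrC subrK.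
by rewrite hq addrC addKr.
Qed.

Definition symmetric_semigroup (N : int) (B : pred int) : Prop :=
  [/\ B 0, forall x y, B x -> B y -> B (x + y), forall x, x < 0 -> ~~ B x
    & forall x, B (N - x) = ~~ B x].

Definition evens_above (N : int) : pred int :=
  fun z => (0 <= z) && (~~ odd `|z| || (N < z)).

(** For [0 <= x <= N], oddness of [N] makes exactly one of [x] and [N - x] even; outside this range
    one is negative and the other exceeds [N]. *)
Lemma evens_above_symmetric (N : nat) :
  odd N -> symmetric_semigroup N%:Z (evens_above N%:Z).
Proof.
rewrite /evens_above => oddN; split; lia.
Qed.

Lemma symmetric_semigroup_gt (N : int) (B : pred int) (x : int) :
  symmetric_semigroup N B -> N < x -> B x.
Proof.
case=> _ _ Bneg Bsym Nx.
by rewrite -[B x]negbK -Bsym; apply: Bneg; rewrite subr_lt0.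
Qed.

Lemma symmetric_semigroup_ge0 (N : int) (B : pred int) (x : int) :
  symmetric_semigroup N B -> B x -> 0 <= x.
Proof. by case=> _ _ Bneg _ Bx; rewrite leNgt; apply/negP => /Bneg; rewrite Bx. Qed.

Lemma symmetric_semigroup_addN (N : int) (B : pred int) (x y : int) :
  symmetric_semigroup N B -> B x -> B y -> x + y <> N.
Proof.
case=> _ _ _ Bsym Bx By xyN.
by move: By; rewrite (_ : y = N - x) ?Bsym ?Bx // -xyN addrC addKr.
Qed.

Definition in_core (B : pred int) (M z : int) : bool := B z && B (M - z).

Lemma sum_in_core (N : int) (B : pred int) (M : int) (l : nat) (f : 'I_l -> int) :
  symmetric_semigroup N B -> (forall i, in_core B M (f i)) ->
  in_core B (l%:Z * M) (\sum_(i < l) f i).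
Proof.
case=> B0 BD _ _ fP.
have -> : l%:Z * M = \sum_(i < l) M by rewrite sumr_const card_ord -mulr_natl natz.
rewrite /in_core -sumrB.
by apply/andP; split; apply: (big_ind (fun x => B x)) => // i _; case/andP: (fP i).
Qed.

(** Induction peels off one summand [z]. Near either end of the interval, [z] absorbs the whole
    offset of [y] from that end; in the middle, [z] can be chosen so that all four numbers to be
    tested exceed [N]. *)
Lemma in_core_sum (N : int) (B : pred int) (M : int) (l : nat) (y : int) :
  symmetric_semigroup N B -> 0 <= N -> 3 * N + 1 < M ->
  in_core B (l.+1%:Z * M) y ->
  exists2 f : 'I_l.+1 -> int, forall i, in_core B M (f i) & \sum_(i < l.+1) f i = y.
Proof.
move=> BP N0 hM; have gt x := @symmetric_semigroup_gt _ _ x BP.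
have ge0 x := @symmetric_semigroup_ge0 _ _ x BP.
have B0 : B 0 by case: BP.
elim: l y => [|l IHl] y yP.
  by exists (fun=> y); rewrite ?big_ord1 // => i; rewrite -[M]mul1r.
suff [z zP yzP] : exists2 z, in_core B M z & in_core B (l.+1%:Z * M) (y - z).
  have [f fP fE] := IHl _ yzP.
  exists (fun i => if unlift ord0 i is Some i' then f i' else z).
    by move=> i; case: unlift.
  rewrite big_ord_recl unlift_none; under eq_bigr do rewrite liftK.
  by rewrite fE addrC subrK.
move: yP; rewrite /in_core.
have -> : l.+2%:Z * M = l.+1%:Z * M + M by rewrite -[l.+2]addn1 PoszD mulrDl mul1r.
have : M <= l.+1%:Z * M by nia.
move: (l.+1%:Z * M) => P MP /andP[By By'].
have [ylo|yhi] := ltP y (M - N).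
  exists y; first by rewrite By gt //; lia.
  by rewrite subrr B0 gt //; lia.
have [y'lo|y'hi] := ltP (P + N) y.
  have Mz : M - (y - P) = P + M - y by ring.
  exists (y - P); first by rewrite Mz By' gt //; lia.
  by rewrite subKr subrr B0 gt //; lia.
(* Here [M - N <= y <= P + N]. The bound on [M] gives [y - (N + 1) > N] in the lower half, and its
   mirror image under [y -> P + M - y] in the upper half. *)
have [yle|ygt] := leP (2 * y) (P + M).
  by exists (N + 1); rewrite !gt //; lia.
by exists (M - N - 1); rewrite !gt //; lia.
Qed.

Lemma complete_sum_free_of_semigroup (N : int) (B : pred int) (M : int)
    (h n : nat) :
  symmetric_semigroup N B -> 0 <= N -> 3 * N + 1 < M -> (0 < h)%N ->
  n%:Z = (2 * h%:Z + 1) * M - 2 * N ->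
  exists S : {set 'Z_n}, symmetric_set S /\ complete_sum_free (h.*2) S.
Proof.
move=> BP N0 hM h0 hn.
have gt x := @symmetric_semigroup_gt _ _ x BP.
have ge0 x := @symmetric_semigroup_ge0 _ _ x BP.
have nadd x y := @symmetric_semigroup_addN _ _ x y BP.
have sym x : B (N - x) = ~~ B x by case: BP.
pose w : int := h%:Z * M - N.
have nE : n%:Z = 2 * w + M by rewrite hn /w; ring.
have wlb : M <= w + N by rewrite /w; nia.
(* For [n <= 1] the type ['Z_n] would be the integers modulo 2. *)
have n1 : (1 < n)%N by lia.
(* [B] has no negative element, so the core lies in [[0, M]] and a finite index type suffices. *)
pose S : {set 'Z_n} :=
  [set x | [exists z : 'I_`|M|.+1, in_core B M z%:Z && (x == (w + z%:Z)%:~R)]].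
have SP x : reflect (exists2 z, in_core B M z & x = (w + z)%:~R) (x \in S).
  rewrite inE; apply: (iffP existsP) => [[z /andP[zP /eqP xE]]|[z zP xE]].
    by exists z%:Z.
  have /andP[/ge0 z0 /ge0 z1] := zP.
  have zM : (`|z| < `|M|.+1)%N by lia.
  by exists (Ordinal zM); rewrite /= gez0_abs // zP xE eqxx.
have lE : (h.*2)%:Z * M = 2 * (w + N) by rewrite /w -mul2n PoszM; ring.
(* [h.*2 w = h n - w - N]. *)
have lS x : reflect (exists2 y, in_core B (2 * (w + N)) y & x = (y - w - N)%:~R)
                    (x \in sumset h.*2 S).
  have shift y : ((h.*2)%:Z * w + y)%:~R = (y - w - N)%:~R :> 'Z_n.
    apply/eqP/(intr_Zp_eqP _ _ n1); exists h%:Z.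
    by rewrite nE /w -mul2n PoszM; ring.
  apply: (iffP imsetP) => [[s]|[y yP xE]].
    rewrite inE => /forallP sS ->.
    have /fin_all_exists2[f fP fE] i := SP _ (sS i).
    exists (\sum_i f i); first by rewrite -lE; apply: sum_in_core BP fP.
    rewrite -shift (eq_bigr _ (fun i _ => fE i)) -(raddf_sum intr) /=.
    by rewrite big_split /= sumr_const card_ord -mulr_natl natz.
  have l0 : h.*2 = h.*2.-1.+1 by lia.
  have [f fP fE] : exists2 f : 'I_h.*2 -> int,
      forall i, in_core B M (f i) & \sum_i f i = y.
    by rewrite l0; apply: (in_core_sum BP N0 hM); rewrite -l0 lE.
  exists [ffun i => (w + f i)%:~R].
    rewrite inE; apply/forallP => i; rewrite ffunE; apply/SP.
    by exists (f i).
  under eq_bigr do rewrite ffunE.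
  by rewrite xE -shift -(raddf_sum intr) /= big_split /= sumr_const card_ord
    -mulr_natl natz fE.
exists S; split.
  (* Since [n = 2 w + M], the reflection [z -> M - z] becomes negation modulo [n]. *)
  move=> x /SP[z /andP[Bz Bz'] ->]; apply/SP; exists (M - z).
    by rewrite /in_core Bz' opprB addrC subrK.
  rewrite -mulrNz; apply/eqP/(intr_Zp_eqP _ _ n1); exists (-1).
  by rewrite nE; ring.
split.
  apply/setP => x; rewrite in_setI in_set0; apply/negP => /andP[/lS[y yP xE] /SP[z zP]].
  rewrite xE => /eqP/(intr_Zp_eqP _ _ n1)[q].
  case/andP: yP => By By'; case/andP: zP => Bz Bz'.
  move=> eq; have := ge0 _ By; have := ge0 _ By'.
  have := ge0 _ Bz; have := ge0 _ Bz' => *.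
  (* Sizes exclude other [q]: [y - w - N] lies in [[-(w + N), w + N]] and [w + z] in [[w, w + M]].
     Then [q = -1] gives [y + (M - z) = N], and [q = 0] gives [(2 (w + N) - y) + z = N]: two
     elements of [B] with sum [N]. *)
  have [q0|q0] : q = - 1 \/ q = 0 by rewrite nE in eq; nia.
    by apply: (nadd _ _ By Bz'); rewrite q0 nE in eq; lia.
  by apply: (nadd _ _ By' Bz); rewrite q0 nE in eq; lia.
apply/setP => x; rewrite in_setU in_setT; apply/orP.
(* Let [y] in [[0, n)] represent [x + w + N]. If [y] fails to be in [B], then [z = y + M - N] has
   [M - z = N - y] in [B]; if [2 (w + N) - y] fails, its reflection in [N] serves as [z]. *)
pose u : 'Z_n := x + (w + N)%:~R.
pose y : int := (nat_of_ord u)%:Z.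
have y0 : 0 <= y by [].
have yn : y < n%:Z by rewrite /y ltz_nat -[X in (_ < X)%N](Zp_cast n1) ltn_ord.
have xE : x = (y - w - N)%:~R.
  by rewrite -addrA -opprD mulrzBr -pmulrn natr_Zp /u addrK.
have xE' q : x = (w + (y - w - N - w + q * n%:Z))%:~R.
  by rewrite xE; apply/eqP/(intr_Zp_eqP _ _ n1); exists (- q); ring.
have [By|By] := boolP (B y); last first.
  right; apply/SP; exists (y - w - N - w + 1 * n%:Z); last exact: xE'.
  have By' : B (N - y) by rewrite sym.
  have := ge0 _ By' => ?; rewrite nE /in_core gt; last by lia.
  have -> : M - (y - w - N - w + 1 * (2 * w + M)) = N - y by ring.
  exact: By'.
have [By'|By'] := boolP (B (2 * (w + N) - y)).
  by left; apply/lS; exists y; rewrite ?xE // /in_core By.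
right; apply/SP; exists (y - w - N - w + 0 * n%:Z); last exact: xE'.
move: By'; rewrite -sym => By'; rewrite /in_core.
have -> : y - w - N - w + 0 * n%:Z = N - (2 * (w + N) - y) by ring.
by rewrite By' gt //; rewrite nE in yn; lia.
Qed.

Theorem theorem1p3 (l t : nat) (hl : (4 <= l)%N) (hl_even : ~~ odd l)
    (ht : (1 <= t)%N) (gamma j r k : int)
    (hgamma : 1 <= l%:Z + 3 - 4 * (t%:Z + 2) + gamma * (2 * l%:Z + 2)
                <= 2 * l%:Z + 2)
    (hj : j = 2 * gamma + 1)
    (hr : r = l%:Z + 3 - 4 * (t%:Z + 2) + gamma * (2 * l%:Z + 2))
    (hk : k >= 4 * t%:Z + 2 * l%:Z + 2 * `|gamma| + 2)
    (n : nat) (hn : n%:Z = (2 * l%:Z + 2) * k + r) :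
  exists S : {set 'Z_n}, symmetric_set S /\ complete_sum_free l S.
Proof.
have lE : l = (l./2).*2 by rewrite even_halfK.
rewrite lE; apply: (@complete_sum_free_of_semigroup (2 * t + 3)%N
  (evens_above (2 * t + 3)%N) (2 * (k + gamma) + 1)).
- by apply: evens_above_symmetric; lia.
- by [].
(* The bound on [k] gives [k + gamma >= 4 t + 2 l + 2], hence [M > 6 t + 10 = 3 N + 1]. *)
- by lia.
- by lia.
- have lE' : l%:Z = 2 * l./2%:Z by lia.
  by rewrite hn hr lE' PoszD PoszM; ring.
Qed.
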